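(* Let $N\ge 1$ and let $H^\alpha:\mathbb{R}\to\mathbb{R}$, $\alpha=1,\dots,N$, be continuous and coercive ($H^\alpha(s)\to+\infty$ as $|s|\to+\infty$). Let $F_0:\mathbb{R}^N\to\mathbb{R}$ be continuous and nonincreasing in each of its arguments. Then $$\underline R\,\overline R F_0=\overline R\,\underline R F_0\quad(=:\mathfrak{R}F_0).$$ Moreover $$\mathfrak{R}F_0=\mathfrak{R}\max(F_0,H_-)\ge H_- .$$
   Context: For $p,q\in\mathbb{R}^N$ with components $p^\alpha,q^\alpha$, $q\le p$ means $q^\alpha\le p^\alpha$ for every $\alpha=1,\dots,N$. Set $H_{\max}(p)=\max_{\alpha}H^\alpha(p^\alpha)$ and $H_{\min}(p)=\min_\alpha H^\alpha(p^\alpha)$. The sub-relaxation and super-relaxation operators (with respect to $H=(H^1,\dots,H^N)$) are $$\underline R F(p)=\sup_{q\ge p}\min\{F(q),H_{\min}(q)\},\qquad \overline R F(p)=\inf_{q\le p}\max\{F(q),H_{\max}(q)\}.$$ Also $H_-(p)=\max_{\alpha=1,\dots,N}H^\alpha_-(p^\alpha)$ with $H^\alpha_-(p^\alpha)=\inf_{q^\alpha\le p^\alpha}H^\alpha(q^\alpha)$ (the lower nonincreasing hull of $H^\alpha$). Here $\max(F_0,H_-)$ is the pointwise maximum, and $\mathfrak{R}$ applied to any continuous function nonincreasing in each argument denotes the common value of $\underline R\,\overline R$ and $\overline R\,\underline R$ applied to that function. *)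

(* Defs.v *)
From HB Require Import structures.
From mathcomp Require Import all_boot all_order all_algebra.
From mathcomp Require Import all_classical all_reals all_analysis.

Set Implicit Arguments.
Unset Strict Implicit.
Unset Printing Implicit Defensive.

Import Order.TTheory GRing.Theory Num.Theory.
Import numFieldNormedType.Exports.

Local Open Scope classical_set_scope.
Local Open Scope ring_scope.

(* The dimension N >= 1 is written n.+1, and a point p of R^N is a row vector
   with components p 0 a. *)

Definition coord_le (R : realType) (n : nat) (q p : 'rV[R]_n.+1) : Prop :=
  forall a : 'I_n.+1, q 0 a <= p 0 a.

Definition nonincreasing_in_each (R : realType) (n : nat)
    (F : 'rV[R]_n.+1 -> R) : Prop :=
  forall (a : 'I_n.+1) (p q : 'rV[R]_n.+1),
    (forall b, b != a -> q 0 b = p 0 b) -> q 0 a <= p 0 a -> F p <= F q.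

Definition coercive (R : realType) (h : R -> R) : Prop :=
  (h s @[s --> +oo] --> +oo) /\ (h s @[s --> -oo] --> +oo).

(* The index type being nonempty, the initial value of the iterated max and
   min is one of the terms. *)
Definition max_coord (R : realType) (n : nat) (h : 'I_n.+1 -> R -> R)
    (p : 'rV[R]_n.+1) : R :=
  \big[Num.max/h ord0 (p 0 ord0)]_(a < n.+1) h a (p 0 a).

Definition min_coord (R : realType) (n : nat) (h : 'I_n.+1 -> R -> R)
    (p : 'rV[R]_n.+1) : R :=
  \big[Num.min/h ord0 (p 0 ord0)]_(a < n.+1) h a (p 0 a).

(* The real-valued sup and inf return the default 0 on sets that are empty or
   unbounded. This never happens for the functions considered here: see
   has_sup_sub_relax, has_inf_super_relax and has_inf_lower_hull below. *)
Definition sub_relax (R : realType) (n : nat) (H : 'I_n.+1 -> R -> R)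
    (F : 'rV[R]_n.+1 -> R) (p : 'rV[R]_n.+1) : R :=
  sup [set Num.min (F q) (min_coord H q) | q in [set q | coord_le p q]].

Definition super_relax (R : realType) (n : nat) (H : 'I_n.+1 -> R -> R)
    (F : 'rV[R]_n.+1 -> R) (p : 'rV[R]_n.+1) : R :=
  inf [set Num.max (F q) (max_coord H q) | q in [set q | coord_le q p]].

Definition lower_hull (R : realType) (h : R -> R) (s : R) : R :=
  inf [set h t | t in [set t | t <= s]].

Definition Hminus (R : realType) (n : nat) (H : 'I_n.+1 -> R -> R) :
    'rV[R]_n.+1 -> R :=
  max_coord (fun a => lower_hull (H a)).

(* Meaningful where the two orders of composition agree. *)
Definition relax (R : realType) (n : nat) (H : 'I_n.+1 -> R -> R)
    (F : 'rV[R]_n.+1 -> R) : 'rV[R]_n.+1 -> R :=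
  sub_relax H (super_relax H F).

Lemma coord_le_refl (R : realType) (n : nat) (p : 'rV[R]_n.+1) : coord_le p p.
Proof. by move=> a. Qed.

Lemma coord_le_trans (R : realType) (n : nat) (p q r : 'rV[R]_n.+1) :
  coord_le p q -> coord_le q r -> coord_le p r.
Proof. by move=> pq qr a; exact: le_trans (pq a) (qr a). Qed.

Lemma nonincreasing_in_eachP (R : realType) (n : nat) (F : 'rV[R]_n.+1 -> R) :
  nonincreasing_in_each F <-> (forall p q, coord_le q p -> F p <= F q).
Proof.
split=> [Fni p q qp|Fni a p q qpE qpa]; last first.
  apply: Fni => b; have [->//|ba] := eqVneq b a; by rewrite qpE.
pose r k : 'rV[R]_n.+1 := \row_a (if (a < k)%N then q 0 a else p 0 a).
have rF k : (k <= n.+1)%N -> F p <= F (r k).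
  elim: k => [|k IH] kn; first by rewrite [r _](_ : _ = p)//; apply/rowP=> a; rewrite mxE.
  apply: le_trans (IH (ltnW kn)) _.
  apply: (Fni (Ordinal kn)) => [b bk|]; rewrite !mxE /=; last by rewrite leqnn ltnn; exact: qp.
  by rewrite ltnS leq_eqVlt -[X in X == k]/(val b) (negbTE (bk : val b != k)).
rewrite -[q](_ : r n.+1 = q); first exact: rF.
by apply/rowP=> a; rewrite mxE ltn_ord.
Qed.

Lemma has_sup_sub_relax (R : realType) (n : nat) (H : 'I_n.+1 -> R -> R)
    (F : 'rV[R]_n.+1 -> R) (p : 'rV[R]_n.+1) :
  nonincreasing_in_each F ->
  has_sup [set Num.min (F q) (min_coord H q) | q in [set q | coord_le p q]].
Proof.
move=> /nonincreasing_in_eachP Fni; split.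
  by exists (Num.min (F p) (min_coord H p)), p => //; exact: coord_le_refl.
by exists (F p) => _ [q /= pq <-]; rewrite ge_min Fni.
Qed.

Lemma has_inf_super_relax (R : realType) (n : nat) (H : 'I_n.+1 -> R -> R)
    (F : 'rV[R]_n.+1 -> R) (p : 'rV[R]_n.+1) :
  nonincreasing_in_each F ->
  has_inf [set Num.max (F q) (max_coord H q) | q in [set q | coord_le q p]].
Proof.
move=> /nonincreasing_in_eachP Fni; split.
  by exists (Num.max (F p) (max_coord H p)), p => //; exact: coord_le_refl.
by exists (F p) => _ [q /= qp <-]; rewrite le_max Fni.
Qed.

Lemma nonincreasing_sub_relax (R : realType) (n : nat) (H : 'I_n.+1 -> R -> R)
    (F : 'rV[R]_n.+1 -> R) :
  nonincreasing_in_each F -> nonincreasing_in_each (sub_relax H F).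
Proof.
move=> Fni; apply/nonincreasing_in_eachP => p q qp.
have [p0 _] := has_sup_sub_relax H p Fni.
have [_ qb] := has_sup_sub_relax H q Fni.
apply: ge_sup => // _ [r /= pr <-]; apply: ub_le_sup => //.
by exists r => //; exact: coord_le_trans qp pr.
Qed.

Lemma nonincreasing_super_relax (R : realType) (n : nat) (H : 'I_n.+1 -> R -> R)
    (F : 'rV[R]_n.+1 -> R) :
  nonincreasing_in_each F -> nonincreasing_in_each (super_relax H F).
Proof.
move=> Fni; apply/nonincreasing_in_eachP => p q qp.
have [_ pb] := has_inf_super_relax H p Fni.
have [q0 _] := has_inf_super_relax H q Fni.
apply: lb_le_inf => // _ [r /= rq <-]; apply: ge_inf => //.
by exists r => //; exact: coord_le_trans rq qp.
Qed.

Lemma has_inf_lower_hull (R : realType) (h : R -> R) (s : R) :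
  continuous h -> coercive h -> has_inf [set h t | t in [set t | t <= s]].
Proof.
move=> hc [_ hNy]; split; first by exists (h s), s => /=.
have /cvgryPge /(_ 0) [M [_ hM]] := hNy.
pose m := Num.min M s - 1.
have ms : m <= s by rewrite /m lerBlDr ge_min lerDl ler01 orbT.
have [|c _ hmin] := @EVT_min R h m s ms.
  by apply: continuous_subspaceT => x; exact: hc.
exists (Num.min 0 (h c)) => _ [t /= ts <-]; rewrite ge_min.
have [tm|mt] := ltP t m; last by rewrite hmin ?orbT// in_itv/= mt.
rewrite hM//; apply: lt_le_trans tm _.
by rewrite /m lerBlDr ge_min lerDl ler01.
Qed.

Lemma nonincreasing_max_Hminus (R : realType) (n : nat)
    (H : 'I_n.+1 -> R -> R) (F : 'rV[R]_n.+1 -> R) :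
  (forall a, continuous (H a)) -> (forall a, coercive (H a)) ->
  nonincreasing_in_each F ->
  nonincreasing_in_each (fun p => Num.max (F p) (Hminus H p)).
Proof.
move=> Hc Hy /nonincreasing_in_eachP Fni; apply/nonincreasing_in_eachP => p q qp.
have hull a : lower_hull (H a) (p 0 a) <= lower_hull (H a) (q 0 a).
  have [_ pb] := has_inf_lower_hull (p 0 a) (Hc a) (Hy a).
  have [q0 _] := has_inf_lower_hull (q 0 a) (Hc a) (Hy a).
  apply: lb_le_inf => // _ [t /= tq <-]; apply: ge_inf => //.
  by exists t => //=; exact: le_trans tq (qp a).
apply: le_max2; first exact: Fni.
rewrite /Hminus /max_coord; apply: bigmax_le => [|a _]; apply: le_trans (hull _) _;
  by apply: (le_bigmax _ (fun a => lower_hull (H a) (q 0 a))).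
Qed.

(* Main.v *)
Require Import Defs.
From mathcomp Require Import all_boot all_order all_algebra.
From mathcomp Require Import all_classical all_reals all_analysis.

Set Implicit Arguments.
Unset Strict Implicit.
Unset Printing Implicit Defensive.

Import Order.TTheory GRing.Theory Num.Theory.
Import numFieldNormedType.Exports.
Local Open Scope classical_set_scope.
Local Open Scope ring_scope.

(** For nonincreasing [F], the sublevel [l] of each composed operator is
    described by points rather than by suprema and infima. If [q <= p] has
    [H q < l] in every coordinate and [r >= p] has [H r > l], the intermediate
    value theorem gives [s] between [q] and [r] with [H s = l] in every
    coordinate. Such a point is admissible for both relaxations, whence one
    inequality. For the other one, let [r] be the componentwise first point
    above [p] where [H >= l]. If [q <= r] has [H q < l], then so does the
    componentwise minimum of [p] and [q], and every point above this minimum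
    where [H > l] lies above [q].

    Since [Hminus H <= max_coord H], replacing [F0] by [max (F0, H_-)] does not
    change [super_relax H F0]. *)

(** The point is the infimum of the [t >= x] with [l <= h t]: coercivity makes this set nonempty,
    and continuity makes it closed, so the infimum is attained. *)
Lemma first_passage (R : realType) (h : R -> R) (x l : R) :
  continuous h -> h s @[s --> +oo] --> +oo ->
  exists r, [/\ x <= r, l <= h r & forall t, x <= t -> l <= h t -> r <= t].
Proof.
move=> hc /cvgryPge /(_ l) [M [_ hM]].
pose S := [set t | x <= t /\ l <= h t].
have S_lb : has_lbound S by exists x => t [].
have S_inf : has_inf S.
  split=> //; exists (Num.max x (M + 1)); split; first by rewrite le_max lexx.
  by apply: hM; rewrite lt_max ltrDl ltr01 orbT.
exists (inf S); split; first by apply: lb_le_inf => [|t []//]; case: S_inf.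
- rewrite leNgt; apply/negP => hl.
  (* Otherwise [h < l] near [inf S], where points of [S] are found. *)
  have /(_ _ (lt_nbhsl hl)) := hc (inf S).
  case=> e /= e0 he; have [t St te] := inf_adherent e0 S_inf.
  have : h t < l.
    apply: he => /=; rewrite distrC ger0_norm ?subr_ge0; last exact: ge_inf.
    by rewrite ltrBlDl.
  by case: St => _ /le_lt_trans /[apply]; rewrite ltxx.
- by move=> t xt lt; apply: ge_inf.
Qed.

Section Relaxations.
Context {R : realType} {n : nat}.
Implicit Types (H : 'I_n.+1 -> R -> R) (F : 'rV[R]_n.+1 -> R).
Implicit Types (p q : 'rV[R]_n.+1) (l : R).

Lemma le_min_coordP H p l :
  l <= min_coord H p <-> forall a, l <= H a (p 0 a).
Proof.
split=> [/bigmin_geP[_ h] a|h]; first exact: h.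
by apply/bigmin_geP.
Qed.

Lemma lt_min_coordP H p l :
  l < min_coord H p <-> forall a, l < H a (p 0 a).
Proof.
split=> [/bigmin_gtP[_ h] a|h]; first exact: h.
by apply/bigmin_gtP.
Qed.

Lemma max_coord_leP H p l :
  max_coord H p <= l <-> forall a, H a (p 0 a) <= l.
Proof.
split=> [/bigmax_leP[_ h] a|h]; first exact: h.
by apply/bigmax_leP.
Qed.

Lemma max_coord_ltP H p l :
  max_coord H p < l <-> forall a, H a (p 0 a) < l.
Proof.
split=> [/bigmax_ltP[_ h] a|h]; first exact: h.
by apply/bigmax_ltP.
Qed.

Lemma le_sub_relax H F p q l : nonincreasing_in_each F ->
  coord_le p q -> l <= F q -> (forall a, l <= H a (q 0 a)) ->
  l <= sub_relax H F p.
Proof.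
move=> Fni pq lF /le_min_coordP lH.
have [_ ub] := has_sup_sub_relax H p Fni.
apply: (@le_trans _ _ (Num.min (F q) (min_coord H q))).
  by rewrite le_min lF.
by apply: ub_le_sup => //; exists q.
Qed.

(** Points with [H <= l] in some coordinate contribute at most [l] to the supremum, so only the
    others need testing. *)
Lemma sub_relax_le H F p l :
  (forall q, coord_le p q -> (forall a, l < H a (q 0 a)) -> F q <= l) ->
  sub_relax H F p <= l.
Proof.
move=> h; apply: ge_sup.
  by exists (Num.min (F p) (min_coord H p)), p => //; exact: coord_le_refl.
move=> _ [q /= pq <-]; rewrite ge_min.
by have [|/lt_min_coordP/h->//] := leP (min_coord H q) l; rewrite ?orbT.
Qed.

Lemma super_relax_le H F p q l : nonincreasing_in_each F ->
  coord_le q p -> F q <= l -> (forall a, H a (q 0 a) <= l) ->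
  super_relax H F p <= l.
Proof.
move=> Fni qp Fl /max_coord_leP Hl.
have [_ lb] := has_inf_super_relax H p Fni.
apply: (@le_trans _ _ (Num.max (F q) (max_coord H q))).
  by apply: ge_inf => //; exists q.
by rewrite ge_max Fl.
Qed.

Lemma super_relax_lt H F p l : super_relax H F p < l ->
  exists q, [/\ coord_le q p, F q < l & forall a, H a (q 0 a) < l].
Proof.
case/inf_lt => [|_ [q /= qp <-]].
  by exists (Num.max (F p) (max_coord H p)), p => //; exact: coord_le_refl.
by rewrite gt_max => /andP[Fl /max_coord_ltP Hl]; exists q.
Qed.

Lemma sub_super_relax_le H F p :
  (forall a, continuous (H a)) -> nonincreasing_in_each F ->
  sub_relax H (super_relax H F) p <= super_relax H (sub_relax H F) p.
Proof.
move=> Hc Fni; apply/unstable.ler_gtP => l /super_relax_lt[q [qp AFq Hq]].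
apply: sub_relax_le => r pr Hr.
have /choice[s sP] a : exists s, q 0 a <= s <= r 0 a /\ H a s = l.
  have qr : q 0 a <= r 0 a := le_trans (qp a) (pr a).
  have [|s] := IVT (v := l) qr (continuous_subspaceT (Hc a)).
    by rewrite ge_min le_max (ltW (Hq a)) (ltW (Hr a)) orbT.
  by rewrite in_itv /=; exists s.
pose v : 'rV[R]_n.+1 := \row_a s a.
have Hv a : H a (v 0 a) = l by rewrite mxE; case: (sP a).
apply: (@super_relax_le _ _ _ v) => // [a||a]; last by rewrite Hv.
  by rewrite mxE; case: (sP a) => /andP[].
(* Were [l < F v], the point [v], above [q] with [H = l], would raise [sub_relax H F q] to [l]. *)
rewrite leNgt; apply/negP => lF; suff : l <= sub_relax H F q by rewrite leNgt AFq.
apply: (@le_sub_relax _ _ _ v) => // [a||a]; last by rewrite Hv.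
  by rewrite mxE; case: (sP a) => /andP[].
exact: ltW.
Qed.

Lemma super_sub_relax_le H F p :
  (forall a, continuous (H a)) -> (forall a, coercive (H a)) ->
  nonincreasing_in_each F ->
  super_relax H (sub_relax H F) p <= sub_relax H (super_relax H F) p.
Proof.
move=> Hc Hy Fni; apply/unstable.ler_gtP => l ABl.
have /choice[r rP] a := first_passage (p 0 a) l (Hc a) (proj1 (Hy a)).
pose v : 'rV[R]_n.+1 := \row_a r a.
have /super_relax_lt[q [qv Fq Hq]] : super_relax H F v < l.
  (* Since [v] lies above [p] with [H >= l], a value [>= l] there would lift the supremum at [p] to
     [l]. *)
  rewrite ltNge; apply: contraPN ABl => lB; apply/negP; rewrite -leNgt.
  apply: (@le_sub_relax _ _ _ v) => // [|a|a]; rewrite ?mxE; try by case: (rP a).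
  exact: nonincreasing_super_relax.
pose m : 'rV[R]_n.+1 := \row_a Num.min (p 0 a) (q 0 a).
apply: (@super_relax_le _ _ _ m) => [|a||a].
- exact: nonincreasing_sub_relax.
- by rewrite mxE ge_min lexx.
(* Where [m] agrees with [p], minimality of [r] gives [q <= r <= t]; hence [q <= t] in every
   coordinate. *)
- apply: sub_relax_le => t mt Ht; apply: le_trans (ltW Fq).
  move/nonincreasing_in_eachP : Fni; apply => a.
  have := mt a; rewrite mxE; case: (leP (p 0 a) (q 0 a)) => // pq pt.
  apply: le_trans (qv a) _; rewrite mxE.
  by case: (rP a) => _ _; apply => //; exact: ltW.
- rewrite mxE; case: (leP (p 0 a) (q 0 a)) => pq; last exact: ltW.
  case: (rP a) => _ _ rmin; rewrite leNgt; apply/negP => lHp.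
  (* Otherwise [p 0 a] is itself the first passage, so that [q 0 a = p 0 a]. *)
  have rp := rmin _ (lexx _) (ltW lHp).
  have qE : q 0 a = p 0 a.
    by apply/le_anti; rewrite pq andbT (le_trans (qv a))// mxE.
  by have := Hq a; rewrite qE ltNge ltW.
Qed.

Lemma relax_comm H F :
  (forall a, continuous (H a)) -> (forall a, coercive (H a)) ->
  nonincreasing_in_each F ->
  sub_relax H (super_relax H F) = super_relax H (sub_relax H F).
Proof.
move=> Hc Hy Fni; apply/funext => p; apply/le_anti.
by rewrite sub_super_relax_le// super_sub_relax_le.
Qed.

(** Each [q 0 a] competes in the infimum defining the hull at [p 0 a]. *)
Lemma Hminus_le_max_coord H p q :
  (forall a, continuous (H a)) -> (forall a, coercive (H a)) ->
  coord_le q p -> Hminus H p <= max_coord H q.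
Proof.
move=> Hc Hy qp; apply/max_coord_leP => a.
apply: (@le_trans _ _ (H a (q 0 a))).
  have [_ lb] := has_inf_lower_hull (p 0 a) (Hc a) (Hy a).
  by apply: ge_inf => //; exists (q 0 a) => //=.
by move: a; apply/max_coord_leP.
Qed.

End Relaxations.

Theorem theorem2p1 (R : realType) (n : nat) (H : 'I_n.+1 -> R -> R)
    (Hcont : forall a, continuous (H a))
    (Hcoer : forall a, coercive (H a))
    (F0 : 'rV[R]_n.+1 -> R)
    (F0cont : continuous F0)
    (F0noninc : nonincreasing_in_each F0) :
  let F1 := fun p => Num.max (F0 p) (Hminus H p) in
  [/\ sub_relax H (super_relax H F0) = super_relax H (sub_relax H F0),
      sub_relax H (super_relax H F1) = super_relax H (sub_relax H F1),
      relax H F0 = relax H F1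
    & forall p, Hminus H p <= relax H F1 p].
Proof.
move=> F1.
have F1ni : nonincreasing_in_each F1 by exact: nonincreasing_max_Hminus.
have F1comm := relax_comm Hcont Hcoer F1ni.
split=> //; first exact: relax_comm.
- congr (sub_relax H _); apply/funext => p; congr (inf _).
  apply: eq_imagel => q _; rewrite /F1 -maxA; congr Num.max.
  by apply/esym/max_idPr/Hminus_le_max_coord => //; exact: coord_le_refl.
(* With the infimum outermost, every competitor is at least [max_coord H q] for some [q <= p]. *)
- move=> p; rewrite /relax F1comm; apply: lb_le_inf.
    by exists (Num.max (sub_relax H F1 p) (max_coord H p)), p => //; exact: coord_le_refl.
  by move=> _ [q /= qp <-]; rewrite le_max (@Hminus_le_max_coord _ _ _ p) ?orbT.
Qed.
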